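(* Let $(X,\mathcal U)$ be a quasi-uniform space whose quasi-uniformity is generated by an $F$-quasi-gauge $D$ (i.e. $\mathcal U=\mathcal U_D$). Suppose that $(X,\mathcal U)$ is sequentially right $K$-complete, that the topology $\tau(\mathcal U)$ is $T_1$, and that $\varphi:X\to\mathbb R\cup\{\infty\}$ is proper, bounded below and sequentially $\mathcal U$-lsc. 1. Let $F:X\rightrightarrows X$ be a set-valued mapping with nonempty values. If for every $x\in X$ there exists $y\in F(x)$ such that $\varphi(y)+d(y,x)\le\varphi(x)$ for all $d\in D$, then there exists $z\in X$ such that $z\in F(z)$. 2. Let $F:X\rightrightarrows X$ be a set-valued mapping with nonempty values. If for every $x\in X$, every $y\in F(x)$ and every $d\in D$ one has $\varphi(y)+d(y,x)\le\varphi(x)$, then there exists $z\in X$ such that $F(z)=\{z\}$. 3. If $f:X\to X$ is a mapping such that $\varphi(f(x))+d(f(x),x)\le\varphi(x)$ for all $d\in D$ and all $x\in X$, then $f$ has a fixed point in $X$.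
   Context: A quasi-uniformity on a set $X$ is a nonempty family $\mathcal U$ of subsets of $X\times X$ which contain the diagonal, closed under supersets and finite intersections, such that for every $U\in\mathcal U$ there is $V\in\mathcal U$ with $V\circ V\subseteq U$, where $M\circ N=\{(x,z):\exists y,\ (x,y)\in M,\ (y,z)\in N\}$. The topology $\tau(\mathcal U)$ has $\{U(x):U\in\mathcal U\}$, $U(x)=\{y\in X:(x,y)\in U\}$, as neighborhood basis at $x$. An $F$-quasi-gauge on $X$ is a family $D$ of functions $d:X\times X\to\mathbb R$ such that: (QF1) $D$ is directed upward (for the pointwise order); (QF2) $d(x,y)\ge 0$ and $d(x,x)=0$ for all $d\in D$, $x,y\in X$; (QF3) for every $d\in D$ there is $d'\in D$ with $d'\ge d$ such that $d(x,y)\le d'(x,z)+d'(z,y)$ for all $x,y,z\in X$. It generates the quasi-uniformity $\mathcal U_D$ having as basis the sets $V_{d,\varepsilon}=\{(x,y)\in X\times X: d(x,y)<\varepsilon\}$, $d\in D$, $\varepsilon>0$. A sequence $(x_n)$ is right $K$-Cauchy if for every $U\in\mathcal U$ there is $n_U\in\mathbb N$ such that $(x_{n+k},x_n)\in U$ for all $n\ge n_U$ and all $k\in\mathbb N$. $(X,\mathcal U)$ is sequentially right $K$-complete if every right $K$-Cauchy sequence is $\tau(\mathcal U)$-convergent to some point of $X$. $\varphi$ is sequentially $\mathcal U$-lsc if $\varphi(x)\le\liminf_n\varphi(x_n)$ whenever $(x_n)$ is a sequence $\tau(\mathcal U)$-convergent to $x$; $\varphi$ is proper if $\{x:\varphi(x)<\infty\}\neq\emptyset$.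 *)

(* Defs.v *)
From HB Require Import structures.
From mathcomp Require Import all_boot all_order all_algebra.
From mathcomp Require Import all_classical all_reals all_analysis.

Set Implicit Arguments.
Unset Strict Implicit.
Unset Printing Implicit Defensive.

Import Order.TTheory GRing.Theory Num.Theory.

Local Open Scope classical_set_scope.
Local Open Scope ring_scope.

(* The axioms of a uniformity without symmetry. Since
   (B \; B) = {(x, z) | exists y, (x, y) \in B and (y, z) \in B}, the order of
   the factors in [\;] is immaterial here. *)
Record quasiUniformity (X : Type) := QuasiUniformity {
  qentourage : set_system (X * X);
  qentourage_filter : Filter qentourage;
  qentourage_diagonal : forall A, qentourage A -> diagonal `<=` A;
  qentourage_split : forall A, qentourage A ->
    exists2 B, qentourage B & (B \; B)%relation `<=` A
}.

(* X carrying the topology tau(U): the neighborhoods of x are the supersets of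
   the sets U(x) = {y | (x, y) \in U}. *)
Definition quasi_top (X : Type) (U : quasiUniformity X) : Type := X.

Section QuasiTopology.
Context (X : Type) (U : quasiUniformity X).

HB.instance Definition _ := gen_eqMixin (quasi_top U).
HB.instance Definition _ := gen_choiceMixin (quasi_top U).
HB.instance Definition _ := @hasNbhs.Build (quasi_top U) (nbhs_ (qentourage U)).

Let quasi_nbhs_filter (x : quasi_top U) : ProperFilter (nbhs x).
Proof.
apply: filter_from_proper; last first.
  by move=> A UA; exists x; apply/mem_set; apply: (qentourage_diagonal UA).
apply: filter_from_filter.
  by exists setT; exact: (@filterT _ _ (qentourage_filter U)).
move=> A B UA UB; exists (A `&` B); last by rewrite xsectionI.
exact: (@filterI _ _ (qentourage_filter U)).
Qed.

Let quasi_nbhs_singleton (x : quasi_top U) (A : set (quasi_top U)) :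
  nbhs x A -> A x.
Proof.
by move=> [B UB BA]; apply/BA/mem_set; apply: (qentourage_diagonal UB).
Qed.

Let quasi_nbhs_nbhs (x : quasi_top U) (A : set (quasi_top U)) :
  nbhs x A -> nbhs x (nbhs^~ A).
Proof.
move=> [B UB BA]; have [C UC CB] := qentourage_split UB.
exists C => // y /set_mem Cxy; exists C => // z /set_mem Cyz.
by apply/BA/mem_set/CB; exists y.
Qed.

HB.instance Definition _ := Nbhs_isNbhsTopological.Build (quasi_top U)
  quasi_nbhs_filter quasi_nbhs_singleton quasi_nbhs_nbhs.

End QuasiTopology.

Definition quasi_cvg (X : Type) (U : quasiUniformity X) (u : nat -> X) (x : X) :=
  (u : nat -> quasi_top U) @ \oo --> (x : quasi_top U).

Definition right_K_cauchy (X : Type) (U : quasiUniformity X) (u : nat -> X) :=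
  forall A, qentourage U A -> exists N : nat, forall n k : nat,
    (N <= n)%N -> A (u (n + k)%N, u n).

Definition seq_right_K_complete (X : Type) (U : quasiUniformity X) :=
  forall u : nat -> X, right_K_cauchy U u -> exists x : X, quasi_cvg U u x.

Definition seq_lsc (R : realType) (X : Type) (U : quasiUniformity X)
    (phi : X -> \bar R) :=
  forall (u : nat -> X) (x : X), quasi_cvg U u x ->
    (phi x <= limn_einf (phi \o u))%E.

(* Nonemptiness of D is not required here; it follows from
   U = qgauge_entourages D, because a quasi-uniformity contains setT. *)
Record F_quasi_gauge (R : realType) (X : Type) (D : set (X -> X -> R)) : Prop :=
  FQuasiGauge {
  qgauge_directed : forall d1 d2, D d1 -> D d2 ->
    exists2 d, D d &
      (forall x y, d1 x y <= d x y) /\ (forall x y, d2 x y <= d x y);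
  qgauge_ge0 : forall d x y, D d -> 0 <= d x y;
  qgauge_refl : forall d x, D d -> d x x = 0;
  qgauge_triangle : forall d, D d ->
    exists2 d', D d' & (forall x y, d x y <= d' x y) /\
      (forall x y z, d x y <= d' x z + d' z y)
}.

Definition qgauge_entourages (R : realType) (X : Type) (D : set (X -> X -> R)) :
    set_system (X * X) :=
  filter_from [set de : (X -> X -> R) * R | D de.1 /\ 0 < de.2]
              (fun de => [set xy | de.1 xy.1 xy.2 < de.2]).

(* Main.v *)
Require Import Defs.
From HB Require Import structures.
From mathcomp Require Import all_boot all_order all_algebra.
From mathcomp Require Import all_classical all_reals all_analysis.
From mathcomp Require Import lra.

(** All three parts follow from the existence of a point z that is minimal for
    the relation saying that y lies below x when phi y + d y x <= phi x for
    every d in D: a selection of points below z, as each part provides, can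
    only return z itself. The triangle inequality up to a larger gauge makes
    this relation transitive.

    The minimal point comes from the usual Ekeland iteration. Starting from a
    point where phi is finite, choose u n.+1 below u n so that phi (u n.+1)
    exceeds the infimum of phi over the points below u n by at most n.+1^-1
    ([minimizing_descent]). Since phi (u n) decreases to a real number,
    d (u (n + k)) (u n) <= phi (u n) - phi (u (n + k)) makes u right K-Cauchy,
    and lower semicontinuity puts its limit z below every u n
    ([descent_lower_bound]). If y lies below z, it lies below every u n, so that
    phi z <= phi (u n.+1) <= phi y + n.+1^-1 for all n; hence phi y = phi z and
    d y z = 0 for every d in D, which the T1 axiom turns into y = z
    ([exists_minimal_point]). *)

Set Implicit Arguments.
Unset Strict Implicit.
Unset Printing Implicit Defensive.

Import Order.TTheory GRing.Theory Num.Theory.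

Local Open Scope classical_set_scope.
Local Open Scope ring_scope.

Definition descent (R : realType) (X : Type) (D : set (X -> X -> R))
    (phi : X -> \bar R) (x : X) : set X :=
  [set y | forall d, D d -> (phi y + (d y x)%:E <= phi x)%E].

Lemma descent_refl (R : realType) (X : Type) (D : set (X -> X -> R))
    (phi : X -> \bar R) (x : X) :
  F_quasi_gauge D -> descent D phi x x.
Proof. by move=> gD d Dd; rewrite (qgauge_refl gD)// adde0. Qed.

Lemma descent_trans (R : realType) (X : Type) (D : set (X -> X -> R))
    (phi : X -> \bar R) (x y z : X) :
  F_quasi_gauge D -> descent D phi x y -> descent D phi y z ->
  descent D phi x z.
Proof.
move=> gD xy yz d /(qgauge_triangle gD)[d' Dd' [_ tri]].
apply: le_trans (xy _ Dd'); apply: le_trans (leeD2r _ (yz _ Dd')).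
by rewrite -addeA leeD2l// -EFinD lee_fin.
Qed.

Lemma descent_le (R : realType) (X : Type) (D : set (X -> X -> R))
    (phi : X -> \bar R) (x y : X) :
  F_quasi_gauge D -> D !=set0 -> descent D phi x y -> (phi y <= phi x)%E.
Proof.
move=> gD [d Dd] /(_ d Dd); apply: le_trans.
by rewrite leeDl// lee_fin (qgauge_ge0 gD).
Qed.

Lemma iter_descent (R : realType) (X : Type) (D : set (X -> X -> R))
    (phi : X -> \bar R) (u : nat -> X) :
  F_quasi_gauge D -> (forall n, descent D phi (u n) (u n.+1)) ->
  forall n k, descent D phi (u n) (u (n + k)%N).
Proof.
move=> gD du n; elim=> [|k IHk]; first by rewrite addn0; exact: descent_refl.
by rewrite addnS; apply: descent_trans IHk (du _).
Qed.

Lemma gauge_nonempty (R : realType) (X : Type) (U : quasiUniformity X)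
    (D : set (X -> X -> R)) :
  qentourage U = qgauge_entourages D -> D !=set0.
Proof.
move=> UD; have := @filterT _ _ (qentourage_filter U).
by rewrite UD => -[[d e] [/= Dd _] _]; exists d.
Qed.

Lemma quasi_cvg_gauge (R : realType) (X : Type) (U : quasiUniformity X)
    (D : set (X -> X -> R)) (u : nat -> X) (x : X) (d : X -> X -> R) (e : R) :
  qentourage U = qgauge_entourages D -> quasi_cvg U u x -> D d -> 0 < e ->
  exists N, forall n, (N <= n)%N -> d x (u n) < e.
Proof.
move=> UD ux Dd e0.
have /ux[N _ uN] : nbhs (x : quasi_top U) [set y | d x y < e].
  exists [set xy | d xy.1 xy.2 < e]; last by move=> y /set_mem.
  by rewrite UD; exists (d, e).
by exists N => n Nn; exact: uN.
Qed.

(** If y and z were distinct, T1 would give a neighborhood of y avoiding z,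
    hence a gauge d and e > 0 with d y z >= e. *)
Lemma accessible_gauge_separated (R : realType) (X : Type)
    (U : quasiUniformity X) (D : set (X -> X -> R)) (y z : X) :
  qentourage U = qgauge_entourages D -> accessible_space (quasi_top U) ->
  (forall d, D d -> d y z = 0) -> y = z.
Proof.
move=> UD T1 yz0; apply: contrapT => yz.
have /T1[A [oA /set_mem Ay /set_mem]] : (y : quasi_top U) != z by exact/eqP.
apply; have [B UB BA] : nbhs (y : quasi_top U) A by exact: open_nbhs_nbhs.
move: UB; rewrite UD => -[[d e] [/= Dd e0] deB].
by apply/BA/mem_set/deB; rewrite /= yz0.
Qed.

(** Finiteness of phi at the starting point makes the infimum of phi over each
    set of lower points real, so that it can be approximated within
    n.+1^-1. *)
Lemma minimizing_descent (R : realType) (X : Type) (D : set (X -> X -> R))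
    (phi : X -> \bar R) (x0 : X) :
  F_quasi_gauge D -> D !=set0 -> (phi x0 < +oo)%E ->
  (exists m : R, forall x, (m%:E <= phi x)%E) ->
  exists u : nat -> X,
    [/\ forall n, (phi (u n) < +oo)%E,
        forall n, descent D phi (u n) (u n.+1) &
        forall n y, descent D phi (u n) y ->
          (phi (u n.+1) <= phi y + n.+1%:R^-1%:E)%E].
Proof.
move=> gD D0 phix0 [m phim].
(* The successor depends on the index, which sets its tolerance; finiteness of
   phi stays inside the statement so that a plain choice function exists. *)
have step (nx : nat * X) : exists y, (phi nx.2 < +oo)%E ->
    descent D phi nx.2 y /\ forall w, descent D phi nx.2 w ->
      (phi y <= phi w + nx.1.+1%:R^-1%:E)%E.
  case: nx => n x /=; have [phix|] := boolP (phi x < +oo)%E; last by exists x.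
  set S := phi @` descent D phi x.
  have Sx : S (phi x) by exists x => //; exact: descent_refl.
  have Sfin : ereal_inf S \is a fin_num.
    rewrite fin_numElt (lt_le_trans (ltNyr m))/=.
      by rewrite (le_lt_trans _ phix)//; exact: ereal_inf_lbound.
    by apply: le_ereal_inf_tmp => _ [y _ <-].
  have n0 : 0 < n.+1%:R^-1 :> R by rewrite invr_gt0.
  have [_ [y xy <-] ylt] := lb_ereal_inf_adherent n0 Sfin.
  exists y => _; split=> // w xw; rewrite (le_trans (ltW ylt))// leeD2r//.
  by apply: ereal_inf_lbound; exists w.
have [next nextP] := choice step.
pose u := fix u n := if n is k.+1 then next (k, u k) else x0.
have ufin n : (phi (u n) < +oo)%E.
  elim: n => // n IHn; have [un _] := nextP (n, u n) IHn.
  exact: le_lt_trans (descent_le gD D0 un) IHn.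
by exists u; split=> // n; have [] := nextP (n, u n) (ufin n).
Qed.

(** Along a descending sequence, phi decreases to a real number L, and
    consecutive drops of phi control the gauges, so the sequence is right
    K-Cauchy. Its limit z lies below each term: in
    d z (u n) <= d' z (u (n + k)) + d' (u (n + k)) (u n)
    the first summand vanishes as k grows, the second is at most
    phi (u n) - L, and phi z <= L by lower semicontinuity. *)
Lemma descent_lower_bound (R : realType) (X : Type) (U : quasiUniformity X)
    (D : set (X -> X -> R)) (phi : X -> \bar R) (u : nat -> X) :
  F_quasi_gauge D -> qentourage U = qgauge_entourages D ->
  seq_right_K_complete U -> seq_lsc U phi ->
  (exists m : R, forall x, (m%:E <= phi x)%E) ->
  (forall n, (phi (u n) < +oo)%E) ->
  (forall n, descent D phi (u n) (u n.+1)) ->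
  exists z, forall n, descent D phi (u n) z.
Proof.
move=> gD UD Ucomplete phi_lsc [m phim] ufin du.
have D0 := gauge_nonempty UD.
pose r n := fine (phi (u n)).
have rE n : phi (u n) = (r n)%:E.
  by rewrite fineK// fin_numElt ufin (lt_le_trans (ltNyr m)).
have drop n k d : D d -> d (u (n + k)%N) (u n) <= r n - r (n + k)%N.
  move=> /(iter_descent gD du n k).
  by rewrite !rE -EFinD lee_fin lerBrDl.
have r_cvg : r @ \oo --> inf (range r).
  apply: nonincreasing_cvgn.
    apply/nonincreasing_seqP => n; rewrite -lee_fin -!rE.
    exact: descent_le gD D0 (du n).
  by exists m => _ [n _ <-]; rewrite -lee_fin -rE.
set L := inf (range r) in r_cvg.
have L_le n : L <= r n.
  apply: ge_inf; last by exists n.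
  by exists m => _ [k _ <-]; rewrite -lee_fin -rE.
have u_cauchy : right_K_cauchy U u.
  move=> A; rewrite UD => -[[d e] [/= Dd e0] deA].
  have /cvgrPdist_lt/(_ e e0)[N _ rN] := r_cvg.
  exists N => n k Nn; apply: deA => /=.
  apply: le_lt_trans (drop _ _ _ Dd) _.
  apply: le_lt_trans (rN n Nn); rewrite distrC.
  by apply: le_trans (ler_norm _); rewrite lerD2l lerN2.
have [z uz] := Ucomplete _ u_cauchy.
have phizL : (phi z <= L%:E)%E.
  have uL : phi \o u @ \oo --> L%:E.
    apply/fine_cvgP; split; last exact: r_cvg.
    by apply: nearW => n /=; rewrite rE.
  have <- : limn_einf (phi \o u) = L%:E.
    by rewrite is_cvg_limn_einfE ?(cvg_lim _ uL)//; apply/cvg_ex; exists L%:E.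
  exact: phi_lsc.
exists z => n d /(qgauge_triangle gD)[d' Dd' [_ tri]].
rewrite (le_trans (leeD2r _ phizL))// rE -EFinD lee_fin.
apply/ler_addgt0Pr => e e0.
have [N uN] := quasi_cvg_gauge UD uz Dd' e0.
have := uN _ (leq_addl n N); have := drop n N _ Dd'.
have := tri z (u n) (u (n + N)%N); have := L_le (n + N)%N.
lra.
Qed.

Lemma exists_minimal_point (R : realType) (X : Type) (U : quasiUniformity X)
    (D : set (X -> X -> R)) (phi : X -> \bar R) :
  F_quasi_gauge D -> qentourage U = qgauge_entourages D ->
  seq_right_K_complete U -> accessible_space (quasi_top U) ->
  (exists x, (phi x < +oo)%E) ->
  (exists m : R, forall x, (m%:E <= phi x)%E) -> seq_lsc U phi ->
  exists z, forall y, descent D phi z y -> y = z.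
Proof.
move=> gD UD Ucomplete T1 [x0 phix0] phi_bd phi_lsc.
have D0 := gauge_nonempty UD.
have [u [ufin du umin]] := minimizing_descent gD D0 phix0 phi_bd.
have [z uz] := descent_lower_bound gD UD Ucomplete phi_lsc phi_bd ufin du.
have [m phim] := phi_bd.
exists z => y zy.
have phizy : (phi z <= phi y)%E.
  apply/lee_addgt0Pr => e e0; have [n] := ltr_add_invr e0; rewrite add0r => ne.
  apply: le_trans (descent_le gD D0 (uz n.+1)) _.
  apply: le_trans (umin n y (descent_trans gD (uz n) zy)) _.
  by rewrite leeD2l// lee_fin ltW.
have phiy_fin : phi y \is a fin_num.
  rewrite fin_numElt (lt_le_trans (ltNyr m))//=.
  apply: le_lt_trans (descent_le gD D0 zy) _.
  exact: le_lt_trans (descent_le gD D0 (uz 0%N)) (ufin 0%N).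
apply: (accessible_gauge_separated UD T1) => d Dd.
apply/le_anti; rewrite (qgauge_ge0 gD)// andbT.
have := le_trans (zy d Dd) phizy.
by rewrite -(fineK phiy_fin) -EFinD lee_fin gerDl.
Qed.

Theorem corollary4p12 (R : realType) (X : Type) (U : quasiUniformity X)
    (D : set (X -> X -> R)) (phi : X -> \bar R)
    (D_gauge : F_quasi_gauge D)
    (U_generated : qentourage U = qgauge_entourages D)
    (U_complete : seq_right_K_complete U)
    (U_T1 : accessible_space (quasi_top U))
    (phi_codomain : forall x, phi x <> -oo%E)
    (phi_proper : exists x, (phi x < +oo)%E)
    (phi_bounded_below : exists m : R, forall x, (m%:E <= phi x)%E)
    (phi_lsc : seq_lsc U phi) :
  [/\ (forall F : X -> set X,
         (forall x, F x !=set0) ->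
         (forall x, exists2 y, F x y &
            forall d, D d -> (phi y + (d y x)%:E <= phi x)%E) ->
         exists z, F z z),
      (forall F : X -> set X,
         (forall x, F x !=set0) ->
         (forall x y d, F x y -> D d -> (phi y + (d y x)%:E <= phi x)%E) ->
         exists z, F z = [set z]) &
      (forall f : X -> X,
         (forall d x, D d -> (phi (f x) + (d (f x) x)%:E <= phi x)%E) ->
         exists z, f z = z)].
Proof.
have [z minz] := exists_minimal_point D_gauge U_generated U_complete U_T1
  phi_proper phi_bounded_below phi_lsc.
split=> [F _ F_descent|F F0 F_descent|f f_descent]; exists z.
- by have [y Fzy /minz yz] := F_descent z; rewrite -[X in F _ X]yz.
- have F_z y : F z y -> y = z by move=> Fzy; apply: minz => d; exact: F_descent.
  have [y Fzy] := F0 z.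
  by apply/seteqP; split=> [|_ ->]; [exact: F_z|rewrite -[X in F _ X](F_z y)].
- by apply: minz => d; exact: f_descent.
Qed.
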